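(* Let $\mathtt{Hol}_{\mathfrak T}$ be a holistic model and $\gamma$ a formula. (1) Suppose an occurrence of $\intercal(\alpha_1,\alpha_2,\alpha_3)$ appears in $Level_i^\gamma$, so that $Level_{i+1}^\gamma=(\beta_1,\dots,\beta_r)$ with $\alpha_1=\beta_{k_1}$, $\alpha_2=\beta_{k_2}$, $\alpha_3=\beta_{k_3}$ the corresponding occurrences ($k_2=k_1+1$, $k_3=k_1+2$). Then $$\mathtt{Hol}^\gamma_{\mathfrak T}(\intercal(\alpha_1,\alpha_2,\alpha_3))={}^{\mathfrak D}\mathtt T_{\mathfrak T}^{(At(\alpha_1),At(\alpha_2),At(\alpha_3))}\Big(Red^{(k_1,k_2,k_3)}_{[At(\beta_1),\dots,At(\beta_r)]}\big(\mathtt{Hol}_{\mathfrak T}(Level_{i+1}^\gamma)\big)\Big).$$ (2) Similarly, if an occurrence of $\alpha_1\uplus\alpha_2$ appears in $Level_i^\gamma$ and $\alpha_1=\beta_{k_1}$, $\alpha_2=\beta_{k_2}$ are the corresponding occurrences in $Level_{i+1}^\gamma=(\beta_1,\dots,\beta_r)$, then $$\mathtt{Hol}^\gamma_{\mathfrak T}(\alpha_1\uplus\alpha_2)={}^{\mathfrak D}\mathtt{XOR}_{\mathfrak T}^{(At(\alpha_1),At(\alpha_2))}\Big(Red^{(k_1,k_2)}_{[At(\beta_1),\dots,At(\beta_r)]}\big(\mathtt{Hol}_{\mathfrak T}(Level_{i+1}^\gamma)\big)\Big).$$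
   Context: Hilbert spaces and states: for $n\ge1$, $\mathcal H^{(n)}=(\mathbb C^2)^{\otimes n}$ with canonical basis $|x_1,\dots,x_n\rangle$ ($x_i\in\{0,1\}$, $|0\rangle=(1,0)$, $|1\rangle=(0,1)$); $\mathfrak D(\mathcal H^{(n)})$ is the set of density operators (qumixes) on $\mathcal H^{(n)}$. A truth-perspective is a unitary $\mathfrak T$ on $\mathbb C^2$, $\mathfrak T^{(n)}=\mathfrak T^{\otimes n}$. $^{\mathfrak T}P_1^{(n)}$ (resp. $^{\mathfrak T}P_0^{(n)}$) is the projection onto the span of the vectors $\mathfrak T^{(n)}|x_1,\dots,x_n\rangle$ with $x_n=1$ (resp. $0$). For $\rho$ on $\mathcal H^{(n_1)}\otimes\cdots\otimes\mathcal H^{(n_t)}$, $Red^{(j_1,\dots,j_s)}_{[n_1,\dots,n_t]}(\rho)$ is the reduced state (partial trace over all factors other than $j_1,\dots,j_s$). Gates (on canonical basis, extended linearly): $\mathtt{NOT}^{(n)}|x_1..x_n\rangle=|x_1..x_{n-1}\rangle\otimes|1-x_n\rangle$; $\sqrt{\mathtt I}^{(n)}|x_1..x_n\rangle=|x_1..x_{n-1}\rangle\otimes\frac1{\sqrt2}((-1)^{x_n}|x_n\rangle+|1-x_n\rangle)$; $\sqrt{\mathtt{NOT}}^{(n)}|x_1..x_n\rangle=|x_1..x_{n-1}\rangle\otimes(\frac{1-i}2|x_n\rangle+\frac{1+i}2|1-x_n\rangle)$; $\mathtt{XOR}^{(m,n)}|x_1..x_m,y_1..y_n\rangle=|x_1..x_m,y_1..y_{n-1}\rangle\otimes|x_m\oplus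 y_n\rangle$; $\mathtt T^{(m,n,p)}|x_1..x_m,y_1..y_n,z_1..z_p\rangle=|x_1..x_m,y_1..y_n,z_1..z_{p-1}\rangle\otimes|x_my_n\oplus z_p\rangle$ ($\oplus$ = addition mod 2). For a gate $G$ on $\mathcal H^{(n)}$: $G_{\mathfrak T}=\mathfrak T^{(n)}G\mathfrak T^{(n)\dagger}$, $^{\mathfrak D}G_{\mathfrak T}(\rho)=G_{\mathfrak T}\rho G_{\mathfrak T}^\dagger$. Language: formulas built from atomic formulas (including distinguished atoms $\mathbf t,\mathbf f$) with unary $\lnot,\sqrt{id},\sqrt\lnot$, binary $\uplus$, ternary $\intercal$. $At(\alpha)$ = number of occurrences of atomic formulas in $\alpha$. Syntactical tree: $Level_1^\alpha=(\alpha)$; $Level_{i+1}^\alpha$ is obtained from $Level_i^\alpha=(\beta_1,\dots,\beta_r)$ by replacing each non-atomic $\beta_j$ by the sequence of its immediate subformulas (its arguments, in order) and keeping atomic $\beta_j$; the last level $Level_h^\alpha$ lists all atomic occurrences. Then $\mathcal H^{(At(\alpha))}=\bigotimes_j\mathcal H^{(At(\beta_j))}$. The $\mathfrak T$-gate $G^\alpha_{\mathfrak T(i)}$ ($1\le i<h$) is the tensor product over $j$ of: identity of $\mathbb C^2$ if $\beta_j$ atomic; $\mathtt{NOT}_{\mathfrak T}^{(At\beta)}$, $\sqrt{\mathtt I}_{\mathfrak T}^{(At\beta)}$, $\sqrt{\mathtt{NOT}}_{\mathfrak T}^{(At\beta)}$ for $\lnot\beta,\sqrt{id}\beta,\sqrt\lnot\beta$;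 $\mathtt{XOR}_{\mathfrak T}^{(At\beta',At\beta'')}$ for $\beta'\uplus\beta''$; $\mathtt T_{\mathfrak T}^{(At\beta',At\beta'',At\beta''')}$ for $\intercal(\beta',\beta'',\beta''')$. Holistic model: a map $\mathtt{Hol}_{\mathfrak T}$ assigning to each level $Level_i^\alpha$ of each formula $\alpha$ a qumix in $\mathfrak D(\mathcal H^{(At(\alpha))})$ such that (a) $\mathtt{Hol}_{\mathfrak T}(Level_i^\alpha)={}^{\mathfrak D}G^\alpha_{\mathfrak T(i)}(\mathtt{Hol}_{\mathfrak T}(Level_{i+1}^\alpha))$ for $1\le i<h$; (b) (normality) for each $\gamma$, with the contextual meaning of the occurrence $\beta_j$ in $Level_i^\gamma=(\beta_1,\dots,\beta_r)$ defined as $Red^{(j)}_{[At\beta_1,\dots,At\beta_r]}(\mathtt{Hol}_{\mathfrak T}(Level_i^\gamma))$, all occurrences of the same subformula $\beta$ in the tree of $\gamma$ have the same contextual meaning, denoted $\mathtt{Hol}^\gamma_{\mathfrak T}(\beta)$; (c) every occurrence of $\mathbf f$ (resp. $\mathbf t$) has contextual meaning $^{\mathfrak T}P_0^{(1)}$ (resp. $^{\mathfrak T}P_1^{(1)}$). *)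

(* Defs.v *)
(* Complex numbers are R[i] for an arbitrary real closed
   field R (mathcomp-real-closed); this covers the usual complex numbers. *)
From HB Require Import structures.
From mathcomp Require Import all_boot all_order all_algebra.
From mathcomp.real_closed Require Import complex.
Set Implicit Arguments. Unset Strict Implicit. Unset Printing Implicit Defensive.
Import Order.TTheory GRing.Theory Num.Theory.
Local Open Scope ring_scope.

Section Quantum.
Variable R : rcfType.
Local Notation C := R[i].

(* ---------- Hilbert space H^(n) = (C^2)^{(x) n}, basis indexed by bit strings *)
Definition bits n := n.-tuple bool.
Definition dim n := #|{: bits n}|.
(* operators on H^(n); the basis vector |x_1..x_n> has index enum_rank x *)
Definition Op n := 'M[C]_(dim n).

Definition ent n (A : Op n) (s s' : seq bool) : C :=
  match insub s : option (bits n), insub s' : option (bits n) with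
  | Some x, Some y => A (enum_rank x) (enum_rank y)
  | _, _ => 0
  end.

Definition mkOp n (f : seq bool -> seq bool -> C) : Op n :=
  \matrix_(i, j) f (val (enum_val i : bits n)) (val (enum_val j : bits n)).

Definition ket n (x : bits n) : 'cV[C]_(dim n) := delta_mx (enum_rank x) 0.

Definition adj m (A : 'M[C]_m) : 'M[C]_m := (map_mx (@conjc R) A)^T.

Definition unitary m (A : 'M[C]_m) := A *m adj A = 1%:M.

Definition density n (rho : Op n) :=
  (forall v : 'cV[C]_(dim n), 0 <= ((map_mx (@conjc R) v)^T *m rho *m v) 0 0)
  /\ \tr rho = 1.

Definition bidx (b : bool) : 'I_2 := if b then ord_max else ord0.

(* T^(n) = T (x) ... (x) T  (n factors) *)
Definition Tpow (T : 'M[C]_2) n : Op n :=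
  mkOp n (fun y x => \prod_(k < n) T (bidx (nth false y k)) (bidx (nth false x k))).

Definition Pproj (T : 'M[C]_2) n (b : bool) : Op n :=
  \sum_(x : bits n | last false x == b)
     (Tpow T n *m ket x) *m (map_mx (@conjc R) (Tpow T n *m ket x))^T.

(* ---------- gates on the canonical basis (column = input, row = output) *)
Definition pre (s : seq bool) := take (size s).-1 s.
Definition lb (s : seq bool) := last false s.
Definition ind (b : bool) : C := if b then 1 else 0.

Definition gNOT n : Op n :=
  mkOp n (fun y x => ind (pre y == pre x) * ind (lb y == ~~ lb x)).

Definition gSqI n : Op n :=
  mkOp n (fun y x => ind (pre y == pre x) *
    (if lb y == lb x then (if lb x then -1 else 1) / (Num.sqrt (2 : R))%:C%C
     else 1 / (Num.sqrt (2 : R))%:C%C)).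

Definition gSqNOT n : Op n :=
  mkOp n (fun y x => ind (pre y == pre x) *
    (if lb y == lb x then (1 - 'i%C) / 2 else (1 + 'i%C) / 2)).

Definition gXOR m n : Op (m + n) :=
  mkOp (m + n) (fun y x => ind (pre y == pre x) *
    ind (lb y == addb (nth false x m.-1) (lb x))).

Definition gToff m n p : Op (m + n + p) :=
  mkOp (m + n + p) (fun y x => ind (pre y == pre x) *
    ind (lb y == addb (nth false x m.-1 && nth false x (m + n).-1) (lb x))).

Definition conjT (T : 'M[C]_2) n (G : Op n) : Op n :=
  Tpow T n *m G *m adj (Tpow T n).
Definition dconj n (G rho : Op n) : Op n := G *m rho *m adj G.

Definition block (ns : seq nat) (k : nat) (s : seq bool) : seq bool :=
  take (nth 0 ns k) (drop (sumn (take k ns)) s).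
Definition kept (ns js : seq nat) (s : seq bool) : seq bool :=
  flatten [seq block ns j s | j <- js].

(* Red^{(js)}_{[ns]} (rho): partial trace over all blocks not in js
   (js are 0-based block indices; K is the number of qubits kept). *)
Definition Red K N (ns js : seq nat) (rho : Op N) : Op K :=
  \matrix_(i, j) \sum_(u : bits N) \sum_(u' : bits N)
    (if [&& [forall k : 'I_(size ns), (val k \notin js) ==>
                 (block ns k u == block ns k u')],
            kept ns js u == val (enum_val i : bits K) &
            kept ns js u' == val (enum_val j : bits K)]
     then rho (enum_rank u) (enum_rank u') else 0).

End Quantum.

Inductive formula :=
| Atom of nat
| Ftrue
| Ffalse
| Fneg of formula
| Fsqid of formula
| Fsqneg of formula
| Fxor of formula & formula
| Ftof of formula & formula & formula.

Fixpoint formula_eqb (a b : formula) : bool :=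
  match a, b with
  | Atom n, Atom m => n == m
  | Ftrue, Ftrue => true
  | Ffalse, Ffalse => true
  | Fneg a, Fneg b => formula_eqb a b
  | Fsqid a, Fsqid b => formula_eqb a b
  | Fsqneg a, Fsqneg b => formula_eqb a b
  | Fxor a1 a2, Fxor b1 b2 => formula_eqb a1 b1 && formula_eqb a2 b2
  | Ftof a1 a2 a3, Ftof b1 b2 b3 =>
      [&& formula_eqb a1 b1, formula_eqb a2 b2 & formula_eqb a3 b3]
  | _, _ => false
  end.

Lemma formula_eqbP : Equality.axiom formula_eqb.
Proof.
elim=> [n|||a IH|a IH|a IH|a1 IH1 a2 IH2|a1 IH1 a2 IH2 a3 IH3]
       [m|||b|b|b|b1 b2|b1 b2 b3] /=; try (by constructor);
  try (by apply: ReflectF => -[]).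
- by apply: (iffP eqP) => [->|[]].
- by apply: (iffP (IH b)) => [->|[]].
- by apply: (iffP (IH b)) => [->|[]].
- by apply: (iffP (IH b)) => [->|[]].
- apply: (iffP andP) => [[/IH1 -> /IH2 ->]|[<- <-]] //.
  by split; [apply/IH1|apply/IH2].
- apply: (iffP and3P) => [[/IH1 -> /IH2 -> /IH3 ->]|[<- <- <-]] //.
  by split; [apply/IH1|apply/IH2|apply/IH3].
Qed.

HB.instance Definition _ := hasDecEq.Build formula formula_eqbP.

Fixpoint At (a : formula) : nat :=
  match a with
  | Atom _ | Ftrue | Ffalse => 1
  | Fneg b | Fsqid b | Fsqneg b => At b
  | Fxor b c => At b + At c
  | Ftof b c d => At b + At c + At d
  end.

Definition expand (a : formula) : seq formula :=
  match a with
  | Atom _ | Ftrue | Ffalse => [:: a]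
  | Fneg b | Fsqid b | Fsqneg b => [:: b]
  | Fxor b c => [:: b; c]
  | Ftof b c d => [:: b; c; d]
  end.

Definition next_level (L : seq formula) := flatten (map expand L).

(* Level_i^alpha, 1-based: Level 1 = (alpha) *)
Definition Level (a : formula) (i : nat) : seq formula :=
  iter i.-1 next_level [:: a].

Fixpoint depth (a : formula) : nat :=
  match a with
  | Atom _ | Ftrue | Ffalse => 0
  | Fneg b | Fsqid b | Fsqneg b => (depth b).+1
  | Fxor b c => (maxn (depth b) (depth c)).+1
  | Ftof b c d => (maxn (depth b) (maxn (depth c) (depth d))).+1
  end.

(* h: index of the last level (listing all atomic occurrences) *)
Definition height (a : formula) := (depth a).+1.

(* the position (0-based) in Level_{i+1} of the first immediate subformula of
   the occurrence at position j (0-based) in Level_i *)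
Definition child_pos (L : seq formula) (j : nat) : nat :=
  size (next_level (take j L)).

Section Holistic.
Variable R : rcfType.
Local Notation C := R[i].

Definition blockGate (T : 'M[C]_2) (b : formula) : Op R (At b) :=
  match b return Op R (At b) with
  | Atom _ | Ftrue | Ffalse => 1%:M
  | Fneg c => conjT T (gNOT R (At c))
  | Fsqid c => conjT T (gSqI R (At c))
  | Fsqneg c => conjT T (gSqNOT R (At c))
  | Fxor c d => conjT T (gXOR R (At c) (At d))
  | Ftof c d e => conjT T (gToff R (At c) (At d) (At e))
  end.

(* G^alpha_{T(i)}: tensor product of the block gates of Level_i^alpha *)
Definition levelGate (T : 'M[C]_2) (a : formula) (i : nat) : Op R (At a) :=
  let L := Level a i in
  let ns := map At L in
  mkOp (At a) (fun y x =>
    \prod_(k < size L) ent (blockGate T (nth Ffalse L k))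
                           (block ns k y) (block ns k x)).

(* contextual meaning of the occurrence at position j (0-based) of Level_i^g,
   viewed as an operator on H^(At b), where b is the formula occurring there *)
Definition ctx (Hol : forall a : formula, nat -> Op R (At a))
    (b g : formula) (i j : nat) : Op R (At b) :=
  Red (At b) [seq At x | x <- Level g i] [:: j] (Hol g i).

Definition holistic (T : 'M[C]_2) (Hol : forall a : formula, nat -> Op R (At a)) :=
  (forall a i, (1 <= i <= height a)%N -> density (Hol a i))
  /\ (forall a i, (1 <= i < height a)%N ->
        Hol a i = dconj (levelGate T a i) (Hol a i.+1))
  /\ (forall g b i j i' j', (1 <= i <= height g)%N -> (1 <= i' <= height g)%N ->
        (j < size (Level g i))%N -> (j' < size (Level g i'))%N ->
        nth Ffalse (Level g i) j = b -> nth Ffalse (Level g i') j' = b ->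
        ctx Hol b g i j = ctx Hol b g i' j')
  /\ (forall g i j, (1 <= i <= height g)%N -> (j < size (Level g i))%N ->
        nth Ffalse (Level g i) j = Ffalse -> ctx Hol Ffalse g i j = Pproj T 1 false)
  /\ (forall g i j, (1 <= i <= height g)%N -> (j < size (Level g i))%N ->
        nth Ffalse (Level g i) j = Ftrue -> ctx Hol Ftrue g i j = Pproj T 1 true).

End Holistic.

(* Main.v *)
(* A tensor factor of a level gate acting on discarded qubits is unitary, hence
   disappears under the partial trace.  The block kept at level i and the
   sequence of its children at level i+1 occupy the same qubits, so both reduced
   states are partial traces over the same prefix and suffix of the qubits. *)
Require Import Defs.
From HB Require Import structures.
From mathcomp Require Import all_boot all_order all_algebra.
From mathcomp.real_closed Require Import complex.
From mathcomp Require Import ring zify.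
Set Implicit Arguments. Unset Strict Implicit. Unset Printing Implicit Defensive.
Import Order.TTheory GRing.Theory Num.Theory.
Local Open Scope ring_scope.

(** * Sums over bit strings, split by concatenation *)

Lemma sum_bits_cat (V : nmodType) m n (F : seq bool -> V) :
  \sum_(u : bits (m + n)) F u = \sum_(a : bits m) \sum_(c : bits n) F (a ++ c).
Proof.
rewrite pair_bigA /=.
have inj : injective (fun p : bits m * bits n => cat_tuple p.1 p.2).
  move=> [a c] [a' c'] /(congr1 val) /= /eqP.
  rewrite eqseq_cat ?size_tuple // => /andP[/eqP e1 /eqP e2].
  by congr (_, _); apply: val_inj.
(* An injection between finite sets of equal size [2^(m+n)] is a bijection, so no inverse has to be
   built. *)
have bij : bijective (fun p : bits m * bits n => cat_tuple p.1 p.2).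
  by apply: (inj_card_bij inj); rewrite card_prod !card_tuple expnD.
by rewrite (reindex _ (onW_bij _ bij)).
Qed.

Lemma sum_bits1 (V : nmodType) (F : seq bool -> V) :
  \sum_(u : bits 1) F u = \sum_(b : bool) F [:: b].
Proof.
rewrite (reindex (fun b : bool => [tuple b])) //.
exists (@thead _ _) => // u _.
by case: (tupleP u) => b t; rewrite theadE (tuple0 t); apply: val_inj.
Qed.

Lemma sum_bits_rcons (V : nmodType) n (F : seq bool -> V) :
  \sum_(u : bits n.+1) F u = \sum_(a : bits n) \sum_(b : bool) F (rcons a b).
Proof.
rewrite -addn1 sum_bits_cat; apply: eq_bigr => a _.
rewrite (sum_bits1 (fun s => F (a ++ s))).
by apply: eq_bigr => b _; rewrite cats1.
Qed.

Lemma bits_cat m n (u : bits (m + n)) :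
  exists a : bits m, exists c : bits n, val u = a ++ c.
Proof.
have sa : size (take m u) == m by rewrite size_takel // size_tuple leq_addr.
have sc : size (drop m u) == n by rewrite size_drop size_tuple addKn.
by exists (Tuple sa), (Tuple sc); rewrite /= cat_take_drop.
Qed.

Lemma sum_dim (V : nmodType) n (F : 'I_(Defs.dim n) -> V) :
  \sum_i F i = \sum_(u : bits n) F (enum_rank u).
Proof. by apply: reindex; apply: onW_bij; exists enum_val; [exact: enum_rankK|exact: enum_valK]. Qed.

(** * Cutting a bit string into consecutive blocks *)

Lemma block_reshape ns k s : block ns k s = nth [::] (reshape ns s) k.
Proof. by rewrite nth_reshape. Qed.

Lemma reshape_cat ns1 ns2 (s1 s2 : seq bool) : size s1 = sumn ns1 ->
  reshape (ns1 ++ ns2) (s1 ++ s2) = reshape ns1 s1 ++ reshape ns2 s2.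
Proof.
elim: ns1 s1 => [|n ns IHns] s1 /= ss; first by rewrite (size0nil ss).
have ns1 : (n <= size s1)%N by rewrite ss leq_addr.
rewrite takel_cat // -IHns ?size_drop ?ss ?addKn //.
by rewrite -{2}(cat_take_drop n s1) -catA drop_size_cat // size_takel.
Qed.

Lemma block_catl ns1 ns2 s1 s2 k : size s1 = sumn ns1 -> (k < size ns1)%N ->
  block (ns1 ++ ns2) k (s1 ++ s2) = block ns1 k s1.
Proof.
by move=> ss kn; rewrite !block_reshape reshape_cat // nth_cat size_reshape kn.
Qed.

Lemma block_catr ns1 ns2 s1 s2 k : size s1 = sumn ns1 ->
  block (ns1 ++ ns2) (size ns1 + k) (s1 ++ s2) = block ns2 k s2.
Proof.
move=> ss; rewrite !block_reshape reshape_cat // nth_cat size_reshape.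
by rewrite ltnNge leq_addr /= addKn.
Qed.

Lemma eq_from_block ns s s' : size s = sumn ns -> size s' = sumn ns ->
  (forall k, (k < size ns)%N -> block ns k s = block ns k s') -> s = s'.
Proof.
move=> ss ss' eqb; rewrite -[s](@reshapeKr _ ns) ?ss // -[s'](@reshapeKr _ ns) ?ss' //.
congr flatten; apply: (@eq_from_nth _ [::]); rewrite !size_reshape // => k kn.
by rewrite -!block_reshape eqb.
Qed.

(** An interval of block indices selects a contiguous segment of the string, and [flatten] undoes
    the [reshape] that cut it. *)
Lemma kept_middle ns1 ms ns2 s1 s s2 : size s1 = sumn ns1 -> size s = sumn ms ->
  kept (ns1 ++ ms ++ ns2) (iota (size ns1) (size ms)) (s1 ++ s ++ s2) = s.
Proof.
move=> ss1 ss; rewrite /kept -[size ns1]addn0 iotaDl -map_comp.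
rewrite -{2}[s](@reshapeKr _ ms) ?ss //; congr flatten.
rewrite -[RHS](mkseq_nth [::]) size_reshape /mkseq.
apply/eq_in_map => k; rewrite mem_iota /= => km.
by rewrite block_catr // block_catl // block_reshape.
Qed.

(** When the kept indices form an interval, the discarded blocks are exactly those of the prefix and
    of the suffix. This turns the matching condition in [Red] into two equalities of strings. *)
Lemma eq_outer_blocks ns1 ms ns2 (a a' y y' c c' : seq bool) :
    size a = sumn ns1 -> size a' = sumn ns1 -> size y = sumn ms ->
    size y' = sumn ms -> size c = sumn ns2 -> size c' = sumn ns2 ->
  [forall k : 'I_(size (ns1 ++ ms ++ ns2)),
    (val k \notin iota (size ns1) (size ms)) ==>
      (block (ns1 ++ ms ++ ns2) k (a ++ y ++ c) ==
       block (ns1 ++ ms ++ ns2) k (a' ++ y' ++ c'))] =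
  (a == a') && (c == c').
Proof.
move=> sa sa' sy sy' sc sc'; apply/forallP/andP => [eqb|[/eqP <- /eqP <-] k].
  have {}eqb k : (k < size (ns1 ++ ms ++ ns2))%N ->
      k \notin iota (size ns1) (size ms) ->
      block (ns1 ++ ms ++ ns2) k (a ++ y ++ c) =
      block (ns1 ++ ms ++ ns2) k (a' ++ y' ++ c').
    by move=> kn kNms; have /implyP/(_ kNms)/eqP := eqb (Ordinal kn).
  split; apply/eqP.
    apply: (eq_from_block sa sa') => k kn.
    rewrite -(block_catl (ms ++ ns2) (y ++ c) sa kn).
    rewrite -(block_catl (ms ++ ns2) (y' ++ c') sa' kn).
    (* Indices below [size ns1] lie to the left of the kept interval. *)
    by apply: eqb; rewrite ?size_cat ?mem_iota; lia.
  apply: (eq_from_block sc sc') => k kn.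
  rewrite -(block_catr ns2 c k sy) -(block_catr ns2 c' k sy').
  rewrite -(block_catr (ms ++ ns2) (y ++ c) _ sa).
  rewrite -(block_catr (ms ++ ns2) (y' ++ c') _ sa').
  (* Indices shifted by [size ns1 + size ms] lie to its right. *)
  by apply: eqb; rewrite ?size_cat ?mem_iota; lia.
case: k => k kn /=; apply/implyP; rewrite mem_iota => kNms; apply/eqP.
have [kn1|n1k] := ltnP k (size ns1); first by rewrite !block_catl.
rewrite -(subnKC n1k) !block_catr //.
have kms : (size ms <= k - size ns1)%N by lia.
by rewrite -(subnKC kms) !block_catr.
Qed.

(** * Operators as functions of bit strings, and orthonormality of their columns *)

Section Operators.
Variable R : rcfType.
Local Notation C := R[i].
Implicit Types (f g h : seq bool -> seq bool -> C).

Lemma entE n (A : Op R n) (x y : bits n) : ent A x y = A (enum_rank x) (enum_rank y).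
Proof. by rewrite /ent !valK. Qed.

Lemma mkOpE n f (x y : bits n) : mkOp n f (enum_rank x) (enum_rank y) = f x y.
Proof. by rewrite mxE !enum_rankK. Qed.

Lemma ent_mkOp n f (x y : bits n) : ent (mkOp n f) x y = f x y.
Proof. by rewrite entE mkOpE. Qed.

(** Stated for functions on plain sequences rather than matrices, so that tensor factors combine by
    concatenation without casts between dimensions. *)
Definition isometric n f :=
  forall x x' : bits n, \sum_(y : bits n) f y x * (f y x')^*%C = (x == x')%:R.

(** Orthonormal columns mean [adj A *m A = 1]; for a square matrix a one-sided inverse is
    two-sided. *)
Lemma isometricP n (A : Op R n) : isometric n (ent A) <-> unitary A.
Proof.
have E (i j : bits n) : (adj A *m A) (enum_rank i) (enum_rank j) =
    \sum_(y : bits n) ent A y j * (ent A y i)^*%C.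
  rewrite mxE sum_dim; apply: eq_bigr => y _.
  by rewrite !mxE !entE mulrC.
split=> [isoA|uA].
- apply/mulmx1C/matrixP => i j; rewrite -(enum_valK i) -(enum_valK j) E isoA.
  by rewrite mxE (inj_eq enum_rank_inj) eq_sym.
- by move=> x x'; rewrite -E (mulmx1C uA) mxE (inj_eq enum_rank_inj) eq_sym.
Qed.

Lemma isometric_mkOp n f : isometric n f -> unitary (mkOp n f).
Proof.
move=> isof; apply/isometricP => x x'; rewrite -isof.
by apply: eq_bigr => y _; rewrite !ent_mkOp.
Qed.

(** The inner product of two columns of a tensor product is the product of the inner products of the
    factors, and the Kronecker delta of a concatenation factors in the same way. *)
Lemma isometric_tensor m n f g h :
    isometric m f -> isometric n g ->
    (forall (a a' : bits m) (c c' : bits n),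
       h (a ++ c) (a' ++ c') = f a a' * g c c') ->
  isometric (m + n) h.
Proof.
move=> isof isog hE u u'.
have [a [c uE]] := bits_cat u; have [a' [c' u'E]] := bits_cat u'.
rewrite (sum_bits_cat m n (fun s => h s u * (h s u')^*%C)).
have -> : (u == u') = (a == a') && (c == c').
  by rewrite -!val_eqE /= uE u'E eqseq_cat ?size_tuple.
rewrite -mulnb natrM -isof -isog mulr_suml; apply: eq_bigr => d _.
rewrite mulr_sumr; apply: eq_bigr => e _.
by rewrite uE u'E !hE rmorphM /= mulrACA.
Qed.

Lemma conjc_ind b : (ind R b)^*%C = ind R b.
Proof. by case: b; [exact: conjc1 | exact: conjc0]. Qed.

Lemma bits_rcons n (u : bits n.+1) : exists p : bits n, exists b, val u = rcons p b.
Proof.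
case: u => s; case/lastP: s => [//|p b] /=; rewrite size_rcons eqSS => sp.
by exists (Tuple sp), b.
Qed.

(* [h p] is the one-qubit gate applied to the last qubit when the first ones
   are in the basis state [p]. *)
Lemma isometric_controlled n (h : seq bool -> bool -> bool -> C) f :
    (forall (p : bits n) c c', \sum_b h p b c * (h p b c')^*%C = (c == c')%:R) ->
    (forall (p q : bits n) b c,
       f (rcons q b) (rcons p c) = ind R (q == p :> seq bool) * h p b c) ->
  isometric n.+1 f.
Proof.
move=> isoh fE u u'.
have [p [c uE]] := bits_rcons u; have [p' [c' u'E]] := bits_rcons u'.
rewrite (sum_bits_rcons n (fun s => f s u * (f s u')^*%C)).
have -> : (u == u') = (p == p') && (c == c').
  by rewrite -!val_eqE /= uE u'E eqseq_rcons.
(* The column of [rcons p c] is supported on outputs with prefix [p]. Hence columns with distinct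
   prefixes are orthogonal, and for equal prefixes the claim is the hypothesis on [h p]. *)
rewrite (big_only1 p) // => [|q qp _]; last first.
  by apply: big1 => b _; rewrite uE fE val_eqE (negPf qp) !mul0r.
have [pp'|pp'] := eqVneq p p'.
  by rewrite /= -(isoh p); apply: eq_bigr => b _; rewrite uE u'E -pp' !fE eqxx !mul1r.
apply: big1 => b _; rewrite uE u'E !fE !val_eqE (negPf pp') /=.
by rewrite mul0r conjc0 mulr0.
Qed.

(** * Unitarity of products, adjoints, [Tpow] and conjugated gates *)

Lemma unitaryM m (A B : 'M[C]_m) : unitary A -> unitary B -> unitary (A *m B).
Proof.
rewrite /unitary /adj map_mxM trmx_mul => uA uB.
by rewrite mulmxA -(mulmxA A) uB mulmx1.
Qed.

Lemma adjK m (A : 'M[C]_m) : adj (adj A) = A.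
Proof. by apply/matrixP=> i j; rewrite !mxE conjcK. Qed.

Lemma unitary_adj m (A : 'M[C]_m) : unitary A -> unitary (adj A).
Proof. by rewrite /unitary adjK; apply: mulmx1C. Qed.

Lemma unitary1 m : unitary (1%:M : 'M[C]_m).
Proof. by rewrite /unitary /adj map_mx1 trmx1 mulmx1. Qed.

Lemma unitary_Tpow (T : 'M[C]_2) n : unitary T -> unitary (Tpow T n).
Proof.
move=> uT; apply: isometric_mkOp; elim: n => [|n IHn].
  move=> x x'; rewrite (tuple0 x) (tuple0 x') eqxx.
  rewrite (big_only1 [tuple]) // => [|y]; last by case/eqP; exact: tuple0.
  by rewrite !big_ord0 conjc1 mulr1.
rewrite -add1n.
apply: (@isometric_tensor 1 n
  (fun y x => T (bidx (nth false y 0)) (bidx (nth false x 0)))) IHn _.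
- move=> x x'.
  rewrite (sum_bits1 (fun y => T (bidx (nth false y 0)) (bidx (nth false x 0)) *
                    (T (bidx (nth false y 0)) (bidx (nth false x' 0)))^*%C)).
  (* The required sum over one output bit is an entry of [adj T *m T], which is the identity because
     [T] is square. *)
  have := mulmx1C uT => /matrixP/(_ (bidx (nth false x' 0)) (bidx (nth false x 0))).
  rewrite mxE !big_ord_recl big_ord0 big_bool /= !mxE addr0 addrC => E.
  rewrite mulrC [X in _ + X]mulrC.
  (* [bidx true] is [ord_max], whereas expanding the sum over ['I_2] produces [lift ord0 ord0]. *)
  have -> : ord_max = lift ord0 ord0 :> 'I_2 by apply: val_inj.
  have -> : (x == x') = (nth false x 0 == nth false x' 0).
    case: (tupleP x) => b t; case: (tupleP x') => b' t'.
    by rewrite (tuple0 t) (tuple0 t') /= -val_eqE /= eqseq_cons andbT.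
  by rewrite {}E; case: (nth _ x 0) (nth _ x' 0) => [] [].
- move=> a a' c c'; case: (tupleP a) => b t; case: (tupleP a') => b' t'.
  by rewrite (tuple0 t) (tuple0 t') /= big_ord_recl.
Qed.

Lemma unitary_conjT (T : 'M[C]_2) n (G : Op R n) :
  unitary T -> unitary G -> unitary (conjT T G).
Proof.
move=> uT uG; have uTn := unitary_Tpow n uT.
by apply: unitaryM (unitary_adj uTn); apply: unitaryM.
Qed.

(** * Unitarity of the logical gates *)

Lemma pre_rcons s b : pre (rcons s b) = s.
Proof. by rewrite /pre size_rcons /= -cats1 take_size_cat. Qed.

Lemma lb_rcons s b : lb (rcons s b) = b.
Proof. by rewrite /lb last_rcons. Qed.

(** The map sending [c] to [k (+) c] permutes the two basis states. One statement serves NOT with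
    [k] true, and XOR and Toffoli with [k] computed from the control bits. *)
Lemma isometric_flip (k c c' : bool) :
  \sum_b ind R (b == k (+) c) * (ind R (b == k (+) c'))^*%C = (c == c')%:R :> C.
Proof.
rewrite big_bool !conjc_ind.
by case: k c c' => [] [] []; rewrite /ind /= !(mulr0, mul0r, mulr1, addr0, add0r).
Qed.

(** The successor guarantees a target qubit: on zero qubits [gNOT] is the zero operator. [At_gt0]
    later provides this form for every formula. *)
Lemma unitary_gNOT n : unitary (gNOT R n.+1).
Proof.
apply/isometric_mkOp/(@isometric_controlled n (fun=> fun b c => ind R (b == ~~ c))).
  by move=> _ c c'; exact: (isometric_flip true).
by move=> p q b c; rewrite !pre_rcons !lb_rcons.
Qed.

Lemma unitary_gXOR m n : unitary (gXOR R m.+1 n.+1).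
Proof.
rewrite /gXOR addnS; apply: isometric_mkOp.
apply: (@isometric_controlled _ (fun p b c => ind R (b == nth false p m (+) c))).
  by move=> p c c'; exact: isometric_flip.
move=> p q b c; rewrite !pre_rcons !lb_rcons nth_rcons size_tuple /=.
(* The control bit, at index [m], precedes the target and is thus read from the prefix alone. *)
by rewrite leq_addr.
Qed.

Lemma unitary_gToff m n p : unitary (gToff R m.+1 n.+1 p.+1).
Proof.
rewrite /gToff addnS; apply: isometric_mkOp.
apply: (@isometric_controlled _ (fun s b c =>
  ind R (b == (nth false s m && nth false s (m + n.+1)) (+) c))).
  by move=> s c c'; exact: isometric_flip.
move=> s q b c; rewrite !pre_rcons !lb_rcons !nth_rcons !size_tuple /=.
by have [-> ->] : (m < m.+1 + n.+1 + p)%N /\ (m + n.+1 < m.+1 + n.+1 + p)%N by lia.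
Qed.

Lemma conj_i : ('i%C : C)^*%C = - 'i%C.
Proof. by apply/eqP; rewrite eq_complex /= oppr0 !eqxx. Qed.

Lemma two_neq0 : (2 : C) != 0.
Proof. by rewrite pnatr_eq0. Qed.

Lemma unitary_gSqI n : unitary (gSqI R n.+1).
Proof.
apply/isometric_mkOp/(@isometric_controlled n (fun=> fun b c =>
    if b == c then (if c then -1 else 1) / (Num.sqrt (2 : R))%:C%C
    else 1 / (Num.sqrt (2 : R))%:C%C)); last first.
  by move=> p q b c; rewrite !pre_rcons !lb_rcons.
move=> _ c c'; rewrite big_bool; set k := (Num.sqrt 2)%:C%C.
have kk : k^-1 * k^-1 = 2^-1.
  by rewrite -invfM -rmorphM /= -expr2 sqr_sqrtr ?ler0n // rmorph_nat.
have kc : (k^-1)^*%C = k^-1 by rewrite fmorphV; congr (_^-1); exact: conjc_real.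
have pc : (1 / k)^*%C = k^-1 by rewrite mul1r kc.
have nc : (-1 / k)^*%C = - k^-1 by rewrite mulN1r -[in RHS]kc; exact: rmorphN.
have t0 := two_neq0.
have hc (b d : bool) : (if b == d then (if d then -1 else 1) / k else 1 / k)^*%C =
    if b == d then (if d then - k^-1 else k^-1) else k^-1.
  by case: (b == d); first case: d.
(* From here on [k] is an arbitrary scalar with [k^-1 * k^-1 = 2^-1]. *)
rewrite !hc; move: kk {kc pc nc hc}; move: k => k kk.
by case: c c' => [] [] /=; rewrite !(mul1r, mulN1r, mulrNN, mulrN, mulNr) kk ?addNr ?subrr //; field.
Qed.

Lemma unitary_gSqNOT n : unitary (gSqNOT R n.+1).
Proof.
apply/isometric_mkOp/(@isometric_controlled n (fun=> fun b c =>
    if b == c then (1 - 'i%C) / 2 else (1 + 'i%C) / 2)); last first.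
  by move=> p q b c; rewrite !pre_rcons !lb_rcons.
have ac : ((1 - 'i%C : C) / 2)^*%C = (1 + 'i%C) / 2.
  have -> : ((1 - 'i%C : C) / 2)^*%C = (1 - ('i%C)^*%C) / 2.
    by rewrite rmorphM rmorphB fmorphV rmorph_nat rmorph1.
  by rewrite conj_i opprK.
have ca : ((1 + 'i%C : C) / 2)^*%C = (1 - 'i%C) / 2.
  by rewrite -ac conjcK.
have ii : 'i%C * 'i%C = -1 :> C by rewrite -expr2 sqr_i.
have := two_neq0.
move=> t0 _ c c'; rewrite big_bool.
have hc (b d : bool) : (if b == d then (1 - 'i%C) / 2 else (1 + 'i%C) / 2 : C)^*%C =
    if b == d then (1 + 'i%C) / 2 else (1 - 'i%C) / 2.
  by case: (b == d).
(* The imaginary unit becomes any [z] with [z * z = -1]. Equal columns give [(1 - z * z) / 2 = 1],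
   distinct ones [(1 + z * z) / 2 = 0]. *)
rewrite !hc; move: ('i%C) ii {ac ca hc} => z ii.
case: c c' => [] [] /=.
- have -> : (1 - z) / 2 * ((1 + z) / 2) + (1 + z) / 2 * ((1 - z) / 2) = (1 - z * z) / 2 by field.
  by rewrite ii opprK divff.
- have -> : (1 - z) / 2 * ((1 - z) / 2) + (1 + z) / 2 * ((1 + z) / 2) = (1 + z * z) / 2 by field.
  by rewrite ii subrr mul0r.
- have -> : (1 + z) / 2 * ((1 + z) / 2) + (1 - z) / 2 * ((1 - z) / 2) = (1 + z * z) / 2 by field.
  by rewrite ii subrr mul0r.
- have -> : (1 + z) / 2 * ((1 - z) / 2) + (1 - z) / 2 * ((1 + z) / 2) = (1 - z * z) / 2 by field.
  by rewrite ii opprK divff.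
Qed.

(** * Partial traces over a prefix and a suffix of the qubits *)

Lemma Red_middle K N ns1 ms ns2 (rho : Op R N) (x x' : bits K) :
    K = sumn ms -> N = sumn (ns1 ++ ms ++ ns2) ->
  ent (Red K (ns1 ++ ms ++ ns2) (iota (size ns1) (size ms)) rho) x x' =
  \sum_(a : bits (sumn ns1)) \sum_(c : bits (sumn ns2))
     ent rho (a ++ x ++ c) (a ++ x' ++ c).
Proof.
rewrite !sumn_cat => EK EN; subst K N; rewrite entE mxE !enum_rankK.
(* [G] is the summand of [Red] extended to all sequences, [ent] being zero on wrong lengths; the
   sums can then be split by concatenation. *)
pose G (u u' : seq bool) : C :=
  if [&& [forall k : 'I_(size (ns1 ++ ms ++ ns2)),
            (val k \notin iota (size ns1) (size ms)) ==>
              (block (ns1 ++ ms ++ ns2) k u == block (ns1 ++ ms ++ ns2) k u')],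
         kept (ns1 ++ ms ++ ns2) (iota (size ns1) (size ms)) u == x &
         kept (ns1 ++ ms ++ ns2) (iota (size ns1) (size ms)) u' == x']
  then ent rho u u' else 0.
have GE (a a' : bits (sumn ns1)) (y y' : bits (sumn ms)) (c c' : bits (sumn ns2)) :
    G (a ++ y ++ c) (a' ++ y' ++ c') =
    if [&& (a == a') && (c == c'), y == x & y' == x']
    then ent rho (a ++ y ++ c) (a' ++ y' ++ c') else 0.
  by rewrite /G eq_outer_blocks ?kept_middle ?size_tuple.
transitivity (\sum_(u : bits (sumn ns1 + (sumn ms + sumn ns2)))
              \sum_(u' : bits (sumn ns1 + (sumn ms + sumn ns2))) G u u').
  by apply: eq_bigr => u _; apply: eq_bigr => u' _; rewrite /G entE.
rewrite (sum_bits_cat _ _ (fun s => \sum_(u' : bits _) G s u')).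
apply: eq_bigr => a _.
rewrite (sum_bits_cat _ _ (fun s => \sum_(u' : bits _) G (a ++ s) u')).
(* For fixed [u = a ++ y ++ c], the only [u'] that can contribute is [a ++ x' ++ c], and it does so
   only when [y] is [x]. *)
have E (y : bits (sumn ms)) (c : bits (sumn ns2)) :
    \sum_(u' : bits (sumn ns1 + (sumn ms + sumn ns2))) G (a ++ y ++ c) u' =
    if y == x then ent rho (a ++ x ++ c) (a ++ x' ++ c) else 0.
  rewrite sum_bits_cat (big_only1 a) // => [|a' a'a _].
    rewrite (sum_bits_cat _ _ (fun s => G _ (a ++ s))).
    rewrite (big_only1 x') // => [|y' y'x _].
      rewrite (big_only1 c) // => [|c' c'c _]; rewrite GE !eqxx.
        by rewrite andbT; case: eqP => [->|].
      by rewrite eq_sym (negPf c'c) !andbF.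
    by apply: big1 => c' _; rewrite GE (negPf y'x) !andbF.
  rewrite (sum_bits_cat _ _ (fun s => G _ (a' ++ s))).
  apply: big1 => y' _; apply: big1 => c' _.
  by rewrite GE [a == _]eq_sym (negPf a'a).
rewrite (big_only1 x) // => [|y yx _].
  by apply: eq_bigr => c _; rewrite E eqxx.
by apply: big1 => c _; rewrite E (negPf yx).
Qed.

Lemma ent_dconj n (G rho : Op R n) (x x' : bits n) :
  ent (dconj G rho) x x' = \sum_(s : bits n) \sum_(s' : bits n)
     ent G x s * ent rho s s' * (ent G x' s')^*%C.
Proof.
rewrite entE !mxE sum_dim exchange_big /=; apply: eq_bigr => s' _.
rewrite mxE sum_dim mulr_suml; apply: eq_bigr => s _.
by rewrite !mxE !entE.
Qed.

Lemma ent_inj n (A B : Op R n) :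
  (forall x y : bits n, ent A x y = ent B x y) -> A = B.
Proof.
move=> AB; apply/matrixP => i j; have := AB (enum_val i) (enum_val j).
by rewrite !entE !enum_valK.
Qed.

(* The gates [f] and [g] on the discarded qubits disappear: only
   [f^* f = 1 = g^* g] is left of them under the partial trace. *)
Lemma partial_trace_tensor_conj n1 m n2 (f B g h : seq bool -> seq bool -> C)
    (rho : seq bool -> seq bool -> C) (x x' : bits m) :
    isometric n1 f -> isometric n2 g ->
    (forall (a a' : bits n1) (y y' : bits m) (c c' : bits n2),
       h (a ++ y ++ c) (a' ++ y' ++ c') = f a a' * (B y y' * g c c')) ->
  \sum_(a : bits n1) \sum_(c : bits n2)
    \sum_(s : bits (n1 + (m + n2))) \sum_(s' : bits (n1 + (m + n2)))
      h (a ++ x ++ c) s * rho s s' * (h (a ++ x' ++ c) s')^*%C =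
  \sum_(s : bits m) \sum_(s' : bits m)
    B x s * (\sum_(a : bits n1) \sum_(c : bits n2)
               rho (a ++ s ++ c) (a ++ s' ++ c)) * (B x' s')^*%C.
Proof.
move=> isof isog hE.
have split3 (F : seq bool -> C) : \sum_(s : bits (n1 + (m + n2))) F s =
    \sum_(p : bits n1 * bits m * bits n2) F (p.1.1 ++ p.1.2 ++ p.2).
  rewrite sum_bits_cat -(pair_bigA _ (fun (q : bits n1 * bits m) (c : bits n2) =>
    F (q.1 ++ q.2 ++ c))) /= -(pair_bigA _ (fun (a : bits n1) (y : bits m) =>
    \sum_(c : bits n2) F (a ++ y ++ c))) /=.
  by apply: eq_bigr => a _; rewrite (sum_bits_cat m n2 (fun s => F (a ++ s))).
(* In this intermediate form the traced outputs are already summed out, and the two deltas are what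
   remains of [f] and [g]. *)
transitivity (\sum_(p : bits n1 * bits m * bits n2)
    \sum_(q : bits n1 * bits m * bits n2)
    B x p.1.2 * rho (p.1.1 ++ p.1.2 ++ p.2) (q.1.1 ++ q.1.2 ++ q.2) *
      (B x' q.1.2)^*%C * ((p.1.1 == q.1.1)%:R * (p.2 == q.2)%:R)).
  pose F (a c s s' : seq bool) := h (a ++ x ++ c) s * rho s s' * (h (a ++ x' ++ c) s')^*%C.
  transitivity (\sum_(a : bits n1) \sum_(c : bits n2)
      \sum_(p : bits n1 * bits m * bits n2) \sum_(q : bits n1 * bits m * bits n2)
      F a c (p.1.1 ++ p.1.2 ++ p.2) (q.1.1 ++ q.1.2 ++ q.2)).
    apply: eq_bigr => a _; apply: eq_bigr => c _.
    rewrite (split3 (fun s => \sum_(s' : bits _) F a c s s')).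
    by apply: eq_bigr => p _; rewrite (split3 (F a c _)).
  (* The sum over the traced outputs [a] and [c] is moved innermost, where it factors into an inner
     product of columns of [f] and one of columns of [g]. *)
  rewrite pair_bigA /= exchange_big /=; apply: eq_bigr => p _.
  rewrite exchange_big /=; apply: eq_bigr => q _.
  rewrite -(isof p.1.1 q.1.1) -(isog p.2 q.2) mulr_suml mulr_sumr.
  rewrite -(pair_bigA _ (fun (a : bits n1) (c : bits n2) =>
    F a c (p.1.1 ++ p.1.2 ++ p.2) (q.1.1 ++ q.1.2 ++ q.2))) /=.
  apply: eq_bigr => a _; rewrite mulr_sumr mulr_sumr; apply: eq_bigr => c _.
  rewrite /F !hE.
  have -> : (f a q.1.1 * (B x' q.1.2 * g c q.2))^*%C =
     (f a q.1.1)^*%C * ((B x' q.1.2)^*%C * (g c q.2)^*%C).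
    by rewrite !rmorphM.
  by ring.
rewrite -(pair_bigA _ (fun (p : bits n1 * bits m) (c : bits n2) =>
    \sum_(q : bits n1 * bits m * bits n2)
    B x p.2 * rho (p.1 ++ p.2 ++ c) (q.1.1 ++ q.1.2 ++ q.2) *
      (B x' q.1.2)^*%C * ((p.1 == q.1.1)%:R * (c == q.2)%:R))) /=.
rewrite -(pair_bigA _ (fun (a : bits n1) (s : bits m) => \sum_(c : bits n2)
    \sum_(q : bits n1 * bits m * bits n2)
    B x s * rho (a ++ s ++ c) (q.1.1 ++ q.1.2 ++ q.2) *
      (B x' q.1.2)^*%C * ((a == q.1.1)%:R * (c == q.2)%:R))) /=.
rewrite exchange_big /=; apply: eq_bigr => s _.
(* The factors [B] are pushed inside the partial trace of [rho], so that both sides sum over the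
   same indices. *)
under [RHS]eq_bigr => s' _.
  rewrite mulr_sumr mulr_suml.
  under eq_bigr => a _ do rewrite mulr_sumr mulr_suml.
  over.
rewrite [RHS]exchange_big /=; apply: eq_bigr => a _.
rewrite [RHS]exchange_big /=; apply: eq_bigr => c _.
rewrite -(pair_bigA _ (fun (q : bits n1 * bits m) (c' : bits n2) =>
    B x s * rho (a ++ s ++ c) (q.1 ++ q.2 ++ c') *
      (B x' q.2)^*%C * ((a == q.1)%:R * (c == c')%:R))) /=.
rewrite -(pair_bigA _ (fun (a' : bits n1) (s' : bits m) => \sum_(c' : bits n2)
    B x s * rho (a ++ s ++ c) (a' ++ s' ++ c') *
      (B x' s')^*%C * ((a == a')%:R * (c == c')%:R))) /=.
(* The deltas force the prefix and suffix of the second index of [rho] to equal those of the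
   first. *)
rewrite (big_only1 a) // => [|a' a'a _].
  apply: eq_bigr => s' _; rewrite (big_only1 c) // => [|c' c'c _].
    by rewrite !eqxx !mulr1.
  by rewrite [c == _]eq_sym (negPf c'c) !mulr0.
apply: big1 => s' _; apply: big1 => c' _.
by rewrite [a == _]eq_sym (negPf a'a) mul0r mulr0.
Qed.

(** * Level gates as tensor products of block gates *)

Lemma At_gt0 a : (0 < At a)%N.
Proof. by elim: a => //= [b ? c ?|b ? c ? d ?]; rewrite ?addn_gt0; lia. Qed.

Lemma unitary_blockGate (T : 'M[C]_2) b : unitary T -> unitary (blockGate T b).
Proof.
move=> uT; case: b => [n|||b|b|b|b c|b c d] /=; try exact: unitary1.
- apply: unitary_conjT => //; case: (At b) (At_gt0 b) => // n _; exact: unitary_gNOT.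
- apply: unitary_conjT => //; case: (At b) (At_gt0 b) => // n _; exact: unitary_gSqI.
- apply: unitary_conjT => //; case: (At b) (At_gt0 b) => // n _; exact: unitary_gSqNOT.
- apply: unitary_conjT => //; case: (At b) (At_gt0 b) => // m _.
  by case: (At c) (At_gt0 c) => // n _; exact: unitary_gXOR.
- apply: unitary_conjT => //; case: (At b) (At_gt0 b) => // m _.
  case: (At c) (At_gt0 c) => // n _; case: (At d) (At_gt0 d) => // p _.
  exact: unitary_gToff.
Qed.

(** The entries of [levelGate] for an arbitrary list of formulas, which allows cutting the list at
    an occurrence. *)
Definition tensorGate (T : 'M[C]_2) L (y x : seq bool) : C :=
  \prod_(k < size L) ent (blockGate T (nth Ffalse L k))
    (block (map At L) k y) (block (map At L) k x).

Lemma tensorGate_cat T L1 L2 y1 x1 y2 x2 :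
    size y1 = sumn (map At L1) -> size x1 = sumn (map At L1) ->
  tensorGate T (L1 ++ L2) (y1 ++ y2) (x1 ++ x2) =
  tensorGate T L1 y1 x1 * tensorGate T L2 y2 x2.
Proof.
move=> sy sx; rewrite /tensorGate.
(* With [F] indexed by natural numbers, the product can be cut at [size L1] and its second half
   shifted back to start at 0. *)
pose F k := ent (blockGate T (nth Ffalse (L1 ++ L2) k))
  (block (map At (L1 ++ L2)) k (y1 ++ y2)) (block (map At (L1 ++ L2)) k (x1 ++ x2)).
rewrite -(big_mkord xpredT F) size_cat (big_cat_nat _ (leq_addr _ _)) //=.
rewrite -{2}[size L1]add0n big_addn addKn !big_mkord; congr (_ * _).
  apply: eq_bigr => k _; rewrite /F map_cat nth_cat ltn_ord.
  by rewrite !block_catl ?size_map.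
apply: eq_bigr => k _; rewrite /F map_cat nth_cat ltnNge leq_addl /= addnK.
by rewrite addnC -(size_map At L1) !block_catr.
Qed.

Lemma tensorGate1 T b y x : size y = At b -> size x = At b ->
  tensorGate T [:: b] y x = ent (blockGate T b) y x.
Proof.
move=> sy sx; rewrite /tensorGate big_ord1 /= /block /= !drop0.
by rewrite !take_oversize ?sy ?sx.
Qed.

Lemma isometric_tensorGate T L : unitary T ->
  isometric (sumn (map At L)) (tensorGate T L).
Proof.
move=> uT; elim: L => [|b L IHL].
  move=> x x'; rewrite (tuple0 x) (tuple0 x') eqxx.
  rewrite (big_only1 [tuple]) // => [|y]; last by case/eqP; exact: tuple0.
  by rewrite /tensorGate !big_ord0 conjc1 mulr1.
apply: (isometric_tensor (proj2 (isometricP _) (unitary_blockGate b uT)) IHL).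
move=> a a' c c'; rewrite -cat1s tensorGate_cat /= ?size_tuple ?addn0 //.
by rewrite tensorGate1 ?size_tuple.
Qed.

(** * Levels of the syntactical tree: each regroups the same qubits *)

Lemma sumn_At_expand b : sumn (map At (expand b)) = At b.
Proof. by case: b => //= *; rewrite ?addn0 ?addnA. Qed.

Lemma sumn_At_next_level L : sumn (map At (next_level L)) = sumn (map At L).
Proof.
elim: L => //= b L IHL.
by rewrite /next_level /= map_cat sumn_cat sumn_At_expand -IHL.
Qed.

Lemma sumn_At_Level a i : sumn (map At (Level a i)) = At a.
Proof.
rewrite /Level; elim: i.-1 => [|k IHk] /=; first by rewrite addn0.
by rewrite sumn_At_next_level.
Qed.

(** Each expansion of a non-atomic formula strictly lowers the depth. Consequently a non-atomic
    occurrence cannot lie in the last level. *)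
Lemma depth_Level a b k : b \in iter k next_level [:: a] -> (0 < depth b)%N ->
  (depth b + k <= depth a)%N.
Proof.
elim: k b => [|k IHk] b /=; first by rewrite inE addn0 => /eqP ->.
case/flattenP => s /mapP[c cL ->] bc b0.
(* The parent [c] is not atomic: otherwise [b] would be [c] and have depth 0. *)
have : (depth b < depth c)%N.
  move: bc b0; case: c {cL} => [n|||c|c|c|c d|c d e] /=; rewrite !inE.
  all: try by move/eqP->.
  - by case/orP => /eqP ->; lia.
  - by case/or3P => /eqP ->; lia.
by move=> bc'; have := IHk c cL; lia.
Qed.

(** * Reduced states across one level *)

Lemma Red_dconj_tensorGate T N L1 b L2 (rho : Op R N) :
    unitary T -> N = sumn (map At (L1 ++ b :: L2)) ->
  Red (At b) (map At (L1 ++ b :: L2)) [:: size L1]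
    (dconj (mkOp N (tensorGate T (L1 ++ b :: L2))) rho) =
  dconj (blockGate T b)
    (Red (At b) (map At (next_level (L1 ++ b :: L2)))
       (iota (size (next_level L1)) (size (expand b))) rho).
Proof.
move=> uT NE; apply: ent_inj => x x'.
have nE : next_level (L1 ++ b :: L2) = next_level L1 ++ expand b ++ next_level L2.
  by rewrite /next_level map_cat flatten_cat.
have NE' : N = (sumn (map At L1) + (At b + sumn (map At L2)))%N.
  by rewrite NE map_cat sumn_cat.
(* The children of [b] fill the same [At b] qubits as [b], and expanding [L1] and [L2] leaves the
   lengths of the prefix and suffix unchanged. *)
have PT (s s' : bits (At b)) : ent (Red (At b) (map At (next_level (L1 ++ b :: L2)))
      (iota (size (next_level L1)) (size (expand b))) rho) s s' =
    \sum_(a : bits (sumn (map At L1))) \sum_(c : bits (sumn (map At L2)))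
      ent rho (a ++ s ++ c) (a ++ s' ++ c).
  rewrite nE !map_cat -(size_map At (next_level L1)) -(size_map At (expand b)).
  rewrite Red_middle ?sumn_At_expand ?sumn_At_next_level //.
  by rewrite !sumn_cat sumn_At_expand !sumn_At_next_level.
rewrite ent_dconj; under [RHS]eq_bigr => s _ do under eq_bigr => s' _ do rewrite PT.
rewrite map_cat -(size_map At L1).
rewrite (@Red_middle _ N (map At L1) [:: At b] (map At L2)) /= ?addn0 //; last first.
  by rewrite sumn_cat.
rewrite -(@partial_trace_tensor_conj _ _ _ (tensorGate T L1) _ (tensorGate T L2)
  (tensorGate T (L1 ++ b :: L2)) (ent rho) x x' (isometric_tensorGate (L := L1) uT)
  (isometric_tensorGate (L := L2) uT)); last first.
  move=> a a' y y' c c'; rewrite -cat1s !tensorGate_cat /= ?addn0 ?size_tuple //.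
  by rewrite tensorGate1 ?size_tuple.
clear NE; subst N; apply: eq_bigr => a _; apply: eq_bigr => c _.
(* The plain concatenations are presented as tuples so that [ent_dconj] applies. *)
transitivity (ent (dconj (mkOp _ (tensorGate T (L1 ++ b :: L2))) rho)
  (cat_tuple a (cat_tuple x c)) (cat_tuple a (cat_tuple x' c))) => //.
by rewrite ent_dconj; apply: eq_bigr => s _; apply: eq_bigr => s' _; rewrite !ent_mkOp.
Qed.

End Operators.

(** Common form of both claims: the model condition linking consecutive levels writes the state at
    level [i] as a conjugate by the level gate, of which only the factor at [b] survives
    reduction. *)
Lemma ctx_holistic (R : rcfType) (T : 'M[R[i]]_2)
    (Hol : forall a : formula, nat -> Op R (At a)) g i j b :
    unitary T -> holistic T Hol -> (1 <= i)%N -> (j < size (Level g i))%N ->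
    nth Ffalse (Level g i) j = b -> (0 < depth b)%N ->
  ctx Hol b g i j = dconj (blockGate T b)
    (Red (At b) (map At (Level g i.+1))
       (iota (child_pos (Level g i) j) (size (expand b))) (Hol g i.+1)).
Proof.
move=> uT [_ [holE _]] i1 jL bE b0.
(* Positive depth of [b] means that level [i] is not the last, as the model condition requires. *)
have ih : (1 <= i < height g)%N.
  have bL : b \in Level g i by rewrite -bE mem_nth.
  by have := depth_Level bL b0; rewrite /height; lia.
have L'E : Level g i.+1 = next_level (Level g i) by case: i i1 {jL bE ih}.
rewrite /ctx holE // /levelGate /child_pos L'E.
have LE := sumn_At_Level g i.
move: (Level g i) jL bE LE {L'E} => L jL bE LE.
(* Cutting the level at [j] makes [child_pos] the length of the expanded prefix. *)
have : L = take j L ++ b :: drop j.+1 L.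
  by rewrite -bE -drop_nth // cat_take_drop.
have := size_takel (ltnW jL).
move: (take j L) (drop _ _) LE {jL bE} => L1 L2 LE sj LL; subst j L.
exact: Red_dconj_tensorGate.
Qed.

Theorem theorem4p9 (R : rcfType) (T : 'M[R[i]]_2)
    (Hol : forall a : formula, nat -> Op R (At a)) (g : formula) :
  unitary T -> holistic T Hol ->
  (* (1) Toffoli *)
  (forall (i j : nat) (a1 a2 a3 : formula),
     (1 <= i)%N -> (j < size (Level g i))%N ->
     nth Ffalse (Level g i) j = Ftof a1 a2 a3 ->
     let k1 := child_pos (Level g i) j in
     ctx Hol (Ftof a1 a2 a3) g i j =
     dconj (conjT T (gToff R (At a1) (At a2) (At a3)))
       (Red (At a1 + At a2 + At a3) [seq At b | b <- Level g i.+1]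
            [:: k1; k1.+1; k1.+2] (Hol g i.+1)))
  /\
  (* (2) XOR *)
  (forall (i j : nat) (a1 a2 : formula),
     (1 <= i)%N -> (j < size (Level g i))%N ->
     nth Ffalse (Level g i) j = Fxor a1 a2 ->
     let k1 := child_pos (Level g i) j in
     ctx Hol (Fxor a1 a2) g i j =
     dconj (conjT T (gXOR R (At a1) (At a2)))
       (Red (At a1 + At a2) [seq At b | b <- Level g i.+1]
            [:: k1; k1.+1] (Hol g i.+1))).
Proof.
move=> uT holT; split=> [i j a1 a2 a3 i1 jL E|i j a1 a2 i1 jL E] k1.
  (* For a concrete connective [iota] over the length of [expand] and [blockGate] compute to the
     stated index list and gate. *)
  exact: (ctx_holistic uT holT i1 jL E).
exact: (ctx_holistic uT holT i1 jL E).
Qed.
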